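(* There exist a compact Hausdorff space $X$ and a point $p \in X$ such that: (1) $\chi(p,X) = w(X) = \aleph_\omega$; (2) for every regular cardinal $\kappa > \omega$, there is no sequence $\langle x_\alpha : \alpha < \kappa\rangle$ of points of $X \setminus \{p\}$ that converges to $p$.
   Context: $\chi(p,X)$, the character of $p$ in $X$, is the least cardinality of a local base at $p$; $w(X)$, the weight of $X$, is the least cardinality of a base for $X$. A $\kappa$-sequence $\langle x_\alpha : \alpha<\kappa\rangle$ converges to $p$ if for every neighborhood $U$ of $p$ there is $\beta<\kappa$ with $x_\alpha\in U$ for all $\alpha\ge\beta$. *)

(* Defs.v *)
From HB Require Import structures.
From mathcomp Require Import all_boot all_order.
From mathcomp Require Import all_classical all_reals topology.
Set Implicit Arguments. Unset Strict Implicit. Unset Printing Implicit Defensive.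
Local Open Scope classical_set_scope.
Local Open Scope card_scope.

Definition card_lt T U (A : set T) (B : set U) := A #<= B /\ ~ (B #<= A).

(* is_aleph n A  <->  |A| = aleph_n.
   aleph_0 : countably infinite;
   aleph_{n+1} : |A| is strictly above some aleph_n subset B of A, and every
   subset of A of strictly smaller cardinality than A has cardinality <= |B|
   (i.e. |A| is the cardinal successor of aleph_n). *)
Fixpoint is_aleph (n : nat) (T : Type) (A : set T) : Prop :=
  match n with
  | 0 => A #= [set: nat]
  | n'.+1 => exists B : set T, B `<=` A /\ is_aleph n' B /\ card_lt B A /\
      forall C : set T, C `<=` A -> card_lt C A -> C #<= B
  end.

Definition card_ge_aleph_omega T (A : set T) : Prop :=
  forall n, exists B : set T, B `<=` A /\ is_aleph n B.

Definition card_aleph_omega T (A : set T) : Prop :=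
  card_ge_aleph_omega A /\
  forall C : set T, C `<=` A -> card_lt C A ->
    exists n (B : set T), B `<=` A /\ is_aleph n B /\ C #<= B.

Definition local_base (X : topologicalType) (p : X) (L : set (set X)) :=
  (forall U, L U -> open U /\ U p) /\
  (forall N, nbhs p N -> exists U, L U /\ U `<=` N).

Definition is_base (X : topologicalType) (B : set (set X)) :=
  (forall U, B U -> open U) /\
  (forall V x, open V -> V x -> exists U, B U /\ U x /\ U `<=` V).

Definition character_aleph_omega (X : topologicalType) (p : X) :=
  (exists L, local_base p L /\ card_aleph_omega L) /\
  (forall L, local_base p L -> card_ge_aleph_omega L).

Definition weight_aleph_omega (X : topologicalType) :=
  (exists B : set (set X), is_base B /\ card_aleph_omega B) /\
  (forall B : set (set X), is_base B -> card_ge_aleph_omega B).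

(* (I, lt) is (order-isomorphic to) a regular cardinal kappa > omega, viewed as
   an initial von Neumann ordinal:
   - lt is a well-founded strict total order;
   - initial ordinal: I is not equinumerous to any proper initial segment;
   - uncountable (kappa > omega);
   - regular: every cofinal subset has cardinality |I| (cf(kappa) = kappa). *)
Definition regular_uncountable_cardinal (I : Type) (lt : I -> I -> Prop) :=
  (forall i, ~ lt i i) /\
  (forall i j k, lt i j -> lt j k -> lt i k) /\
  (forall i j, lt i j \/ i = j \/ lt j i) /\
  well_founded lt /\
  (forall i, ~ ([set: I] #<= [set j | lt j i])) /\
  ~ countable [set: I] /\
  (forall C : set I, (forall i, exists j, C j /\ (i = j \/ lt i j)) ->
      [set: I] #<= C).

Definition seq_converges (I : Type) (lt : I -> I -> Prop) (X : topologicalType)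
  (x : I -> X) (p : X) :=
  forall U, nbhs p U -> exists b, forall a, (a = b \/ lt b a) -> U (x a).

(* Main.v *)
Require Import Defs.
From HB Require Import structures.
From mathcomp Require Import all_boot all_order.
From mathcomp Require Import all_classical all_reals topology.
From mathcomp Require wochoice.
Local Open Scope classical_set_scope.
Local Open Scope card_scope.

(** Let [M] be the disjoint union of the cardinals [omega_n] and fix, for each
    [b] in [omega_(n+1)], an injection [e_b] of the predecessors of [b] into
    [omega_n].  Call [N] included in [M] a subalgebra if it contains [omega_0]
    and if, whenever [b] is in [N] and [a < b], [a] is in [N] iff [e_b a] is.
    This is the Jonsson algebra construction: a subalgebra that contains
    [omega_(n+1)] many points of [omega_(n+1)] contains all of it.

    The space consists of all subalgebras, topologized as a closed subset of
    [2^M], and [p] is [M].  Fewer than [aleph_omega] elements generate a proper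
    subalgebra, so the character of [p] is [aleph_omega].  If a
    [kappa]-sequence [x_a <> M] converged to [M], then the intersections of its
    tails would form an increasing [kappa]-chain of proper subalgebras with
    union [M].  Since the [omega_n] are Jonsson, each of them is contained in
    some member of the chain, hence so is [M], [kappa] being regular and
    uncountable. *)

(** * Cardinal arithmetic *)

(** A multivalued injection suffices, since choice extracts a function; codings can then be given as
    relations, with no canonical value to choose. *)
Lemma card_le_relP {T U} (A : set T) (B : set U) :
  A #<= B <-> exists R : T -> U -> Prop,
    (forall x, A x -> exists2 y, B y & R x y) /\
    (forall x x' y, A x -> A x' -> R x y -> R x' y -> x = x').
Proof.
split=> [/card_leP[f]|[R [Rtot Rinj]]].
  exists (fun x y => exists2 a : A, val a = x & val (f a) = y); split.
    move=> x Ax; exists (val (f (SigSub (mem_set Ax)))); first exact: set_valP.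
    by exists (SigSub (mem_set Ax)).
  move=> _ _ y _ _ [a <- ay] [b <- b_y]; congr (val _).
  by apply: (@inj _ _ _ f); rewrite ?inE //; apply: val_inj; rewrite ay b_y.
(* [U] may be empty when [A] is; otherwise the code [y0] of a point of [A] is the default value
   outside [A]. *)
have [A0|/set0P[x0 Ax0]] := eqVneq A set0; first by rewrite A0 card_ge0.
have [y0 _ _] := Rtot _ Ax0.
have /choice[f fP] : forall x, exists y, A x -> B y /\ R x y.
  move=> x; have [Ax|nAx] := pselect (A x); last by exists y0.
  by have [y By Rxy] := Rtot _ Ax; exists y.
have /injfunPex[g] : exists2 f : T -> U, set_fun A B f & set_inj A f.
  exists f => [x Ax|x x' /set_mem Ax /set_mem Ax' ff]; first exact: (fP _ Ax).1.
  by apply: (Rinj _ _ (f x)) => //; [|rewrite ff]; exact: (fP _ _).2.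
exact: inj_card_le g.
Qed.

Lemma card_le_fun {T U} {A : set T} {B : set U} (f : T -> U) :
  (forall x, A x -> B (f x)) ->
  (forall x x', A x -> A x' -> f x = f x' -> x = x') -> A #<= B.
Proof.
move=> fB finj; apply/card_le_relP; exists (fun x y => f x = y); split.
  by move=> x Ax; exists (f x) => //; exact: fB.
by move=> x x' y Ax Ax' fx fx'; apply: finj => //; rewrite fx.
Qed.

Lemma card_le_surj {T U} {A : set T} {B : set U} (g : U -> T) :
  (forall x, A x -> exists2 y, B y & g y = x) -> A #<= B.
Proof.
move=> gA; apply/card_le_relP; exists (fun x y => g y = x); split => // x x' y.
by move=> _ _ <- <-.
Qed.

Lemma card_le_subset {T U} (A : set T) (B : set U) :
  A #<= B -> exists2 C : set U, C `<=` B & A #= C.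
Proof.
move=> /card_le_relP[R [Rtot Rinj]].
have [A0|/set0P[x0 Ax0]] := eqVneq A set0.
  by exists set0 => //; rewrite A0 card_eq00.
have [y0 _ _] := Rtot _ Ax0.
have /choice[f fP] : forall x, exists y, A x -> B y /\ R x y.
  move=> x; have [Ax|nAx] := pselect (A x); last by exists y0.
  by have [y By Rxy] := Rtot _ Ax; exists y.
exists (f @` A); first by move=> _ [x Ax <-]; exact: (fP _ Ax).1.
apply: Cantor_Bernstein; last exact: card_image_le.
apply: (card_le_fun f) => [x Ax|x x' Ax Ax' ff]; first by exists x.
by apply: (Rinj _ _ (f x)) => //; [|rewrite ff]; exact: (fP _ _).2.
Qed.

(** Zorn's lemma gives a maximal partial bijection between [A] and [B]. It exhausts one side, since
    otherwise an unmatched pair could be added. *)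
Lemma card_le_total {T U} (A : set T) (B : set U) : A #<= B \/ B #<= A.
Proof.
pose P := [set G : set (T * U) | (forall z, G z -> A z.1 /\ B z.2) /\
  (forall z w, G z -> G w -> z.1 = w.1 <-> z.2 = w.2)].
have [F FP Ftot|G [[GAB Ginj] Gmax]] := @Zorn_bigcup _ P.
  split=> [z [G FG Gz]|z w [G FG Gz] [H FH Hw]]; first exact: (FP _ FG).1.
  have [GH|HG] := Ftot _ _ FG FH; first by apply: (FP _ FH).2 => //; exact: GH.
  by apply: (FP _ FG).2 => //; exact: HG.
have [At|/existsNP[x /not_implyP[Ax nx]]] :=
    pselect (forall x, A x -> exists y, G (x, y)).
  left; apply/card_le_relP; exists (fun x y => G (x, y)); split.
    by move=> x /At[y Gxy]; exists y => //; exact: (GAB _ Gxy).2.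
  by move=> x x' y _ _ Gx Gx'; apply/(Ginj _ _ Gx Gx').
right; apply/card_le_relP; exists (fun y x => G (x, y)); split; last first.
  by move=> y y' z _ _ Gy Gy'; apply/(Ginj _ _ Gy Gy').
move=> y By; have [[x' Gx'y]|ny] := pselect (exists x', G (x', y)).
  by exists x' => //; exact: (GAB _ Gx'y).1.
exfalso; apply: (Gmax (G `|` [set (x, y)])).
  split; first by move=> z; left.
  by move=> /(_ (x, y)) /(_ (or_intror erefl)) Gxy; apply: nx; exists y.
split=> [z [/GAB//|->//]|[z1 z2] [w1 w2]].
move=> [Gz|[-> ->]] [Gw|[-> ->]] //=; first exact: (Ginj _ _ Gz Gw).
  split=> [zx|zy]; first by exfalso; apply: nx; exists z2; rewrite -zx.
  by exfalso; apply: ny; exists z1; rewrite -zy.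
split=> [zx|zy]; first by exfalso; apply: nx; exists w2; rewrite zx.
by exfalso; apply: ny; exists w1; rewrite zy.
Qed.

Lemma card_le_setX {T U T' U'} {A : set T} {B : set U} {A' : set T'} {B' : set U'} :
  A #<= A' -> B #<= B' -> A `*` B #<= A' `*` B'.
Proof.
move=> /card_le_relP[R [Rt Ri]] /card_le_relP[S [St Si]]; apply/card_le_relP.
exists (fun x y => R x.1 y.1 /\ S x.2 y.2); split.
  move=> [x y] [/= /Rt[x' Ax' Rx] /St[y' By' Sy]].
  by exists (x', y').
move=> [x1 x2] [y1 y2] [z1 z2] [/= A1 B1] [/= A2 B2] [R1 S1] [R2 S2].
by rewrite (Ri x1 y1 z1) // (Si x2 y2 z2).
Qed.

(** Two distinct points of [D] tag the copies of [A] and [B] inside the square of [D]. The bound on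
    the square is a hypothesis because the lemma serves in proving that bound for all infinite
    sets. *)
Lemma card_le_setU_square {T V} (A B : set T) (D : set V) :
  infinite_set D -> D `*` D #<= D -> A #<= D -> B #<= D -> A `|` B #<= D.
Proof.
move=> Dinf DD /card_le_relP[R [Rt Ri]] /card_le_relP[S [St Si]].
apply: (card_le_trans _ DD).
have [d0 Dd0] := infinite_setN0 Dinf.
have [d1 [Dd1 d10]] : exists d1, D d1 /\ d1 <> d0.
  apply: contrapT => /forallNP nD; apply: Dinf.
  apply: sub_finite_set (finite_set1 d0) => d Dd.
  by apply: contrapT => dd0; apply: (nD d).
apply/card_le_relP.
exists (fun x y => (y.1 = d0 /\ A x /\ R x y.2) \/
                   (y.1 = d1 /\ B x /\ S x y.2)); split.
  move=> x [/[dup] Ax /Rt[y Dy Rxy]|/[dup] Bx /St[y Dy Rxy]].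
    by exists (d0, y) => //; left.
  by exists (d1, y) => //; right.
move=> x x' [y1 y2] _ _ /= [[-> [Ax Rx]]|[-> [Bx Sx]]]
  [[e [Ax' Rx']]|[e [Bx' Sx']]].
- exact: (Ri _ _ y2).
- by case: d10.
- by case: d10.
- exact: (Si _ _ y2).
Qed.

(* [G] is the graph of a (possibly multivalued) injection [D `*` D -> D]. *)
Definition pairing {T} (D : set T) (G : set (T * T * T)) :=
  [/\ forall x y z, G (x, y, z) -> [/\ D x, D y & D z],
      forall x y, D x -> D y -> exists z, G (x, y, z) &
      forall x y x' y' z, G (x, y, z) -> G (x', y', z) -> (x, y) = (x', y')].

Lemma pairingP {T} (D : set T) : D `*` D #<= D <-> exists G, pairing D G.
Proof.
split=> [/card_le_relP[R [Rt Ri]]|[G [GD Gt Gi]]].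
  exists [set z | [/\ D z.1.1, D z.1.2, D z.2 & R z.1 z.2]]; split=> //=.
  - by move=> x y z [].
  - by move=> x y Dx Dy; have [|z Dz Rz] := Rt (x, y) _; [|exists z].
  - by move=> x y x' y' z [Dx Dy Dz Rz] [Dx' Dy' _ Rz']; apply: (Ri _ _ z).
apply/card_le_relP; exists (fun x z => G (x, z)); split.
  move=> [x y] [/= Dx Dy]; have [z Gz] := Gt _ _ Dx Dy.
  by exists z => //; have [] := GD _ _ _ Gz.
by move=> [x y] [x' y'] z _ _; exact: Gi.
Qed.

(** Each clause of [pairing] involves at most two triples, and these lie in a common pairing. The
    domain is read off the diagonal of [H]. *)
Lemma pairing_bigcup {T} (H : set (T * T * T)) (A : set T) :
  (forall z w, H z -> H w -> exists D K,
    [/\ D `<=` A, pairing D K, K `<=` H, K z & K w]) ->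
  exists2 D, D `<=` A & pairing D H.
Proof.
move=> Hdir; exists [set x | exists z, H (x, x, z)].
  move=> x [z Hz]; have [D [K [DA [KD _ _] _ Kz _]]] := Hdir _ _ Hz Hz.
  by apply: DA; have [] := KD _ _ _ Kz.
split.
- move=> x y z Hz; have [D [K [DA [KD Kt _] KH Kz _]]] := Hdir _ _ Hz Hz.
  have [Dx Dy Dz] := KD _ _ _ Kz.
  have sq t : D t -> exists s, H (t, t, s).
    by move=> Dt; have [s Ks] := Kt t t Dt Dt; exists s; exact: KH.
  by split; exact: sq.
- move=> x y [z Hz] [w Hw].
  have [D [K [DA [KD Kt _] KH Kz Kw]]] := Hdir _ _ Hz Hw.
  have [Dx _ _] := KD _ _ _ Kz; have [Dy _ _] := KD _ _ _ Kw.
  by have [s Ks] := Kt x y Dx Dy; exists s; exact: KH.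
- move=> x y x' y' z Hz Hw.
  have [D [K [DA [KD Kt Ki] KH Kz Kw]]] := Hdir _ _ Hz Hw.
  exact: Ki Kz Kw.
Qed.

(** The pairs from the union that are not in the square of [D] form three products of size at most
    that of [D]. They are coded in [E], and as [E] misses [D] the new codes never clash with the old
    ones. *)
Lemma pairing_extend {T} (D E : set T) (G : set (T * T * T)) :
  infinite_set D -> pairing D G -> D #= E -> E `<=` ~` D ->
  exists2 G', G `<` G' & pairing (D `|` E) G'.
Proof.
move=> Dinf DG DE ED.
have DD : D `*` D #<= D by apply/pairingP; exists G.
have /card_eqPle[leDE leED] := DE.
have : (D `*` E `|` E `*` D) `|` E `*` E #<= E.
  apply: card_le_trans leDE; have X := card_le_setX.
  apply: card_le_setU_square => //.
    by apply: card_le_setU_square => //; apply: card_le_trans DD; apply: X.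
  by apply: card_le_trans DD; apply: X.
move=> /card_le_relP[S [St Si]]; have [GD Gt Gi] := DG.
pose new (z : T * T * T) := [/\ ((D `*` E `|` E `*` D) `|` E `*` E) z.1,
  E z.2 & S z.1 z.2].
exists (G `|` new).
  split; first by move=> z; left.
  have [d Dd] := infinite_setN0 Dinf.
  have [e Ee] : E !=set0.
    apply: infinite_setN0 => Efin; apply: Dinf.
    by apply: card_le_finite leDE Efin.
  have [|z Ez Sz] := St (e, e) _; first by right.
  have neweez : new (e, e, z) by split => //; right.
  by move=> /(_ _ (or_intror neweez)) /GD[De _ _]; exact: ED Ee De.
split.
- move=> x y z [/GD[]|]; first by split; left.
  by move=> [/= [[[]|[]]|[]] /= ? ? ? ?]; split; (by left) || (by right).
- move=> x y xDE yDE; have [[Dx Dy]|nD] := pselect (D x /\ D y).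
    by have [z Gz] := Gt x y Dx Dy; exists z; left.
  have xy : ((D `*` E `|` E `*` D) `|` E `*` E) (x, y).
    case: xDE yDE => [Dx|Ex] [Dy|Ey].
    - by case: nD.
    - by left; left.
    - by left; right.
    - by right.
  by have [z Ez Sz] := St _ xy; exists z; right; split.
- move=> x y x' y' z [Gz|[xy Ez Sz]] [Gz'|[xy' Ez' Sz']].
  + exact: Gi Gz Gz'.
  + by have [_ _ Dz] := GD _ _ _ Gz; case: (ED _ Ez').
  + by have [_ _ Dz] := GD _ _ _ Gz'; case: (ED _ Ez).
  + exact: Si Sz Sz'.
Qed.

(** A maximal pairing extending a countable one has a domain [D] as large as [A]: otherwise the rest
    of [A] contains a copy of [D], and the pairing extends. *)
Lemma card_le_square {T} (A : set T) : infinite_set A -> A `*` A #<= A.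
Proof.
move=> /infiniteP /card_le_subset[D0 D0A natD0].
have /card_eqPle[leND leDN] := natD0.
have D0inf : infinite_set D0 by apply/infiniteP.
have [G0 G0P] : exists G, pairing D0 G.
  apply/pairingP; apply: card_le_trans leND.
  apply: (@card_le_trans _ _ _ ([set: nat] `*` [set: nat])).
    exact: card_le_setX.
  by apply: countableP.
(* Adjoining [G0] inside [P] makes the union of the empty chain admissible as well. *)
pose P := [set G : set (T * T * T) | exists2 D, D `<=` A & pairing D (G0 `|` G)].
have [F FP Ftot|G [[D DA DG] Gmax]] := @Zorn_bigcup _ P.
  have sub0 G : F G -> G0 `|` G `<=` G0 `|` \bigcup_(X in F) X.
    by move=> FG z [G0z|Gz]; [left|right; exists G].
  apply: pairing_bigcup => z w [G0z|[G FG Gz]] [G0w|[H FH Hw]].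
  - by exists D0, G0; split => // u; left.
  - have [D DA DH] := FP _ FH; exists D, (G0 `|` H).
    by split => //; [exact: sub0|left|right].
  - have [D DA DG] := FP _ FG; exists D, (G0 `|` G).
    by split => //; [exact: sub0|right|left].
  - have [GH|HG] := Ftot _ _ FG FH.
      have [D DA DH] := FP _ FH; exists D, (G0 `|` H).
      by split => //; [exact: sub0|right; exact: GH|right].
    have [D DA DG] := FP _ FG; exists D, (G0 `|` G).
    by split => //; [exact: sub0|right|right; exact: HG].
have D0D : D0 `<=` D.
  move=> x D0x; have [_ G0t _] := G0P; have [z G0z] := G0t x x D0x D0x.
  by have [GD _ _] := DG; have [] := GD _ _ _ (or_introl G0z).
have Dinf : infinite_set D by apply: sub_infinite_set D0D D0inf.
have DD : D `*` D #<= D by apply/pairingP; exists (G0 `|` G).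
have AD : A #<= D.
  have [ADD|] := card_le_total (A `\` D) D.
    apply: (@card_le_trans _ _ _ (D `|` (A `\` D))); last exact: card_le_setU_square.
    by apply: subset_card_le => x Ax; have [?|?] := pselect (D x); [left|right].
  move=> /card_le_subset[E EAD DE].
  have [|G' GG' DEG'] := pairing_extend _ _ _ Dinf DG DE; first by move=> x /EAD[].
  exfalso; apply: (Gmax G').
    split=> [z Gz|G'G]; first by apply: GG'.1; right.
    by apply: GG'.2 => z /G'G; right.
  exists (D `|` E); first by move=> x [/DA//|/EAD[]].
  rewrite (_ : G0 `|` G' = G') //; apply/setUidPr => z G0z.
  by apply: GG'.1; left.
apply: (card_le_trans (card_le_setX AD AD)); apply: (card_le_trans DD).
exact: subset_card_le.
Qed.

(** A point is coded by the code of an index [i] together with its own code within [F i]. Several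
    [i] may qualify, hence the relational form. *)
Lemma card_le_bigcup {I T U} (D : set I) (F : I -> set T) (B : set U) :
  infinite_set B -> D #<= B -> (forall i, D i -> F i #<= B) ->
  \bigcup_(i in D) F i #<= B.
Proof.
move=> Binf /card_le_relP[R [Rt Ri]] FB.
apply: card_le_trans (card_le_square _ Binf).
have /choice[S SP] : forall i, exists S : T -> U -> Prop, D i ->
    (forall x, F i x -> exists2 y, B y & S x y) /\
    (forall x x' y, F i x -> F i x' -> S x y -> S x' y -> x = x').
  move=> i; have [Di|nDi] := pselect (D i); last by exists (fun _ _ => True).
  by have /card_le_relP[S ?] := FB _ Di; exists S.
apply/card_le_relP.
exists (fun x y => exists i, [/\ D i, F i x, R i y.1 & S i x y.2]); split.
  move=> x [i Di Fix]; have [y1 By1 Ry1] := Rt _ Di.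
  have [y2 By2 Sy2] := (SP _ Di).1 _ Fix.
  by exists (y1, y2) => //; exists i.
move=> x x' [y1 y2] _ _ /= [i [Di Fix Riy Sxy]] [j [Dj Fjx Rjy Sxy']].
have ij : i = j by exact: Ri Riy Rjy.
by rewrite -ij in Fjx Sxy'; exact: (SP _ Di).2 Sxy Sxy'.
Qed.

Lemma card_le_setU {T U} (A B : set T) (D : set U) :
  infinite_set D -> A #<= D -> B #<= D -> A `|` B #<= D.
Proof. by move=> Di; apply: card_le_setU_square => //; exact: card_le_square. Qed.

Lemma card_le_seq {T U} (B : set U) :
  infinite_set B -> [set: T] #<= B -> [set: seq T] #<= B.
Proof.
move=> Binf TB.
rewrite (_ : [set: seq T] = \bigcup_(k in [set: nat]) [set s | size s = k]).
  apply: card_le_bigcup => //; first exact/infiniteP.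
  elim=> [|k IH] _.
    apply: (@card_le_trans _ _ _ [set: nat]); last exact/infiniteP.
    by apply: (card_le_fun size) => // s s' /size0nil -> /size0nil ->.
  apply: (card_le_trans _ (card_le_square _ Binf)).
  apply: (card_le_trans _ (card_le_setX TB (IH I))).
  apply: (card_le_surj (fun z : T * seq T => z.1 :: z.2)) => -[//|x s] [sk].
  by exists (x, s).
by apply/seteqP; split=> // s _; exists (size s).
Qed.

(** * The cardinals [aleph_n] *)

Definition strict_well_order {T} (lt : T -> T -> Prop) :=
  [/\ forall x, ~ lt x x,
      forall x y z, lt x y -> lt y z -> lt x z,
      forall x y, [\/ lt x y, x = y | lt y x] &
      forall A : set T, A !=set0 ->
        exists2 x, A x & forall y, A y -> ~ lt y x].

Lemma strict_well_order_ex T : exists lt : T -> T -> Prop, strict_well_order lt.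
Proof.
have [R Rwo] := wochoice.well_ordering_principle {classic T}.
have minP (A : set T) : A !=set0 -> exists2 x, A x & forall y, A y -> R x y.
  move=> [x Ax]; have [|z [[Az zmin] _]] := Rwo [pred x : {classic T} | `[< A x >]].
    by exists x; apply/asboolP.
  by exists z; [exact/asboolP|move=> y Ay; apply: zmin; exact/asboolP].
(* Least elements of sets of at most three points yield totality and transitivity; uniqueness of the
   least element of a pair yields antisymmetry. *)
have min3 (x y z : T) : exists2 t,
    [\/ t = x, t = y | t = z] & [/\ R t x, R t y & R t z].
  have [|t tP tmin] := minP [set t | [\/ t = x, t = y | t = z]].
    by exists x; constructor.
  by exists t => //; split; apply: tmin; [constructor 1|constructor 2|constructor 3].
have anti x y : R x y -> R y x -> x = y.
  move=> xy yx; have Rxx t : R t t by have [? [->|->|->] []] := min3 t t t.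
  have [|z [_ zmin]] := Rwo [pred t : {classic T} | (t == x) || (t == y)].
    by exists x; rewrite inE eqxx.
  rewrite -(zmin x) ?(zmin y) //; split; rewrite ?inE ?eqxx ?orbT // => t;
    by rewrite inE => /orP[/eqP->|/eqP->].
exists (fun x y => x <> y /\ R x y); split.
- by move=> x [].
- move=> x y z [xy Rxy] [yz Ryz].
  have [t [->|->|->] [Rx Ry Rz]] := min3 x y z.
  + by split => // xz; subst z; apply: xy; exact: anti.
  + by case: xy; exact: anti.
  + by case: yz; exact: anti.
- move=> x y; have [->|xy] := pselect (x = y); first by constructor 2.
  have [t [->|->|->] [Rx Ry _]] := min3 x y x.
  + by constructor 1.
  + by constructor 3; split => // yx; apply: xy.
  + by constructor 1.
- move=> A /minP[x Ax xmin]; exists x => // y Ay [yx Ryx].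
  by apply: yx; apply: anti => //; exact: xmin.
Qed.

Definition wo_lt {T : Type} : T -> T -> Prop :=
  projT1 (cid (strict_well_order_ex T)).

Lemma wo_ltP T : strict_well_order (@wo_lt T).
Proof. exact: projT2 (cid _). Qed.

(** * Successor cardinals by Hartogs' construction *)

Lemma Cantor_card T : ~ ([set: set T] #<= [set: T]).
Proof.
move=> /card_le_relP[R [Rt Ri]].
pose D := [set y | exists S, R S y /\ ~ S y].
have [y _ RDy] := Rt D I.
have nDy : ~ D y by move=> /[dup] Dy [S [RSy]]; rewrite (Ri S D y).
by apply: (nDy); exists D.
Qed.

(** An initial segment of a well-ordering of the power set; for infinite [T] its order type is the
    cardinal successor of [T]. *)
Definition hartogs (T : Type) : Type :=
  {t : set T | [set s | wo_lt s t] #<= [set: T]}.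

Definition hlt {T} (a b : hartogs T) := wo_lt (sval a) (sval b).

Section Hartogs.
Variable T : Type.
Implicit Types a b c : hartogs T.

Lemma hlt_trans a b c : hlt a b -> hlt b c -> hlt a c.
Proof. by have [_ + _ _] := wo_ltP (set T); apply. Qed.

Lemma hlt_total a b : [\/ hlt a b, a = b | hlt b a].
Proof.
have [_ _ /(_ (sval a) (sval b)) [ab|ab|ba] _] := wo_ltP (set T).
- by constructor 1.
- by constructor 2; case: a b ab => [a ap] [b bp] /= ab; exact: eq_exist.
- by constructor 3.
Qed.

Lemma card_hlt b : [set a | hlt a b] #<= [set: T].
Proof.
apply: (card_le_trans _ (proj2_sig b)); apply: (card_le_fun sval) => //.
by move=> [x xp] [y yp] _ _ /= xy; exact: eq_exist.
Qed.

(** If every [t] qualifies, this is Cantor's theorem. Otherwise all predecessors of the least [t]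
    that fails are in [hartogs T], so a small [hartogs T] would make [t] qualify. *)
Lemma card_hartogsN : ~ ([set: hartogs T] #<= [set: T]).
Proof.
move=> HT; have [all|/existsNP tP] :=
  pselect (forall t : set T, [set s | wo_lt s t] #<= [set: T]).
  apply: (@Cantor_card T); apply: (card_le_trans _ HT).
  by apply: (card_le_fun (fun t => exist _ t (all t))) => // x y _ _ [].
have [_ _ _ /(_ [set t | ~ ([set s | wo_lt s t] #<= [set: T])] tP)] :=
  wo_ltP (set T).
move=> [t tN tmin]; apply: tN; apply: (card_le_trans _ HT).
apply: (card_le_surj (fun a => sval a)) => s st.
have sP : [set r | wo_lt r s] #<= [set: T].
  by apply: contrapT => sN; exact: tmin _ sN st.
by exists (exist _ s sP).
Qed.

Lemma card_le_hartogs : [set: T] #<= [set: hartogs T].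
Proof.
by have [//|/card_hartogsN] := card_le_total [set: T] [set: hartogs T].
Qed.

Hypothesis Tinf : infinite_set [set: T].

(** The closed initial segments ending at points of a cofinal [C] cover [hartogs T], and each has
    size at most that of [T]. *)
Lemma card_unbounded (C : set (hartogs T)) U (B : set U) :
  (forall a, exists2 c, C c & ~ hlt c a) -> C #<= B -> [set: T] #<= B ->
  [set: hartogs T] #<= B.
Proof.
move=> Cub CB TB; have Binf : infinite_set B.
  by apply/infiniteP; apply: card_le_trans TB; exact/infiniteP.
rewrite (_ : setT = \bigcup_(c in C) ([set a | hlt a c] `|` [set c])); last first.
  apply/seteqP; split=> // a _; have [c Cc ca] := Cub a.
  by exists c => //; case: (hlt_total a c) => [|->|]; [left|right|].
apply: card_le_bigcup => // c Cc; apply: card_le_setU => //.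
  exact: card_le_trans (card_hlt c) TB.
apply: (card_le_trans _ TB); apply: (card_le_trans _ ((infiniteP _).1 Tinf)).
exact: countable1.
Qed.

Lemma hartogs_regular (C : set (hartogs T)) :
  C #<= [set: T] -> exists b, forall c, C c -> hlt c b.
Proof.
move=> CT; apply: contrapT => /forallNP nb; apply: card_hartogsN.
apply: (@card_unbounded C) => // a; have /existsNP[c /not_implyP[Cc ca]] := nb a.
by exists c.
Qed.

Lemma hartogs_succ (C : set (hartogs T)) :
  ~ ([set: hartogs T] #<= C) -> C #<= [set: T].
Proof.
move=> HC; have [//|TC] := card_le_total C [set: T].
have [Cub|/existsNP[a nC]] := pselect (forall a, exists2 c, C c & ~ hlt c a).
  by case: HC; exact: card_unbounded.
apply: (card_le_trans _ (card_hlt a)); apply: subset_card_le => c Cc.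
by apply: contrapT => ca; apply: nC; exists c.
Qed.

Lemma hartogs_injections : exists e : hartogs T -> hartogs T -> T,
  forall b a a', hlt a b -> hlt a' b -> e b a = e b a' -> a = a'.
Proof.
have [t0 _] := infinite_setN0 Tinf.
have /choice[e eP] : forall b, exists f : hartogs T -> T,
    forall a a', hlt a b -> hlt a' b -> f a = f a' -> a = a'.
  move=> b; have /card_le_relP[R [Rt Ri]] := card_hlt b.
  have /choice[f fP] : forall a, exists y, hlt a b -> R a y.
    move=> a; have [ab|nab] := pselect (hlt a b); last by exists t0.
    by have [y _ Ray] := Rt _ ab; exists y.
  exists f => a a' ab a'b ff.
  by apply: (Ri _ _ (f a)) => //; [exact: fP|rewrite ff; exact: fP].
by exists e.
Qed.

End Hartogs.

Fixpoint aleph (n : nat) : Type := if n is m.+1 then hartogs (aleph m) else nat.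

Lemma aleph_infinite n : infinite_set [set: aleph n].
Proof.
elim: n => [|n IH]; first exact: infinite_nat.
by apply/infiniteP; apply: card_le_trans (card_le_hartogs _); exact/infiniteP.
Qed.

(** [is_aleph] speaks only of subsets of the given set, so its witnesses have to be carried along
    the bijection. *)
Lemma is_aleph_eq n T U (A : set T) (B : set U) :
  A #= B -> is_aleph n A -> is_aleph n B.
Proof.
elim: n T U A B => [|n IH] T U A B AB /=.
  by apply: card_eq_trans; rewrite card_eq_sym.
have /card_eqPle[leAB leBA] := AB.
move=> [A' [A'A [alA' [[_ nAA'] A'max]]]].
have [B' B'B A'B'] := card_le_subset _ _ (card_le_trans (subset_card_le A'A) leAB).
have /card_eqPle[leAB' leBA'] := A'B'.
exists B'; split => //; split; first exact: IH alA'.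
split; first split; first exact: subset_card_le.
  move=> BB'; apply: nAA'; apply: (card_le_trans leAB).
  exact: card_le_trans BB' leBA'.
move=> C CB [_ nBC].
have [C' C'A CC'] := card_le_subset _ _ (card_le_trans (subset_card_le CB) leBA).
have /card_eqPle[leCC' leC'C] := CC'.
apply: (card_le_trans leCC'); apply: card_le_trans leAB'; apply: A'max => //.
split; first exact: subset_card_le.
move=> AC'; apply: nBC; apply: (card_le_trans leBA).
exact: card_le_trans AC' leC'C.
Qed.

Lemma is_aleph_aleph n : is_aleph n [set: aleph n].
Proof.
elim: n => [|n IH]; first exact: card_eqxx.
have [B BH AB] := card_le_subset _ _ (card_le_hartogs (aleph n)).
have /card_eqPle[leAB leBA] := AB.
exists B; split => //; split; first exact: is_aleph_eq IH.
split; first split; first exact: subset_card_le.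
  by move=> HB; apply: (@card_hartogsN (aleph n)); exact: card_le_trans HB leBA.
move=> C _ [_ nHC]; apply: card_le_trans leAB.
by apply: hartogs_succ => //; exact: aleph_infinite.
Qed.

Definition aleph_sum : Type := {n & aleph n}.

Lemma card_ge_aleph_omegaP T (S : set T) :
  (forall n, [set: aleph n] #<= S) -> card_ge_aleph_omega S.
Proof.
move=> AS n; have [B BS AB] := card_le_subset _ _ (AS n).
by exists B; split => //; apply: is_aleph_eq AB _; exact: is_aleph_aleph.
Qed.

Lemma card_aleph_sum_le T (S : set T) :
  (forall n, [set: aleph n] #<= S) -> [set: aleph_sum] #<= S.
Proof.
move=> AS; have Sinf : infinite_set S by apply/infiniteP; exact: AS 0.
rewrite (_ : setT = \bigcup_(n in [set: nat]) range (existT aleph n)); last first.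
  by apply/seteqP; split=> // -[n a] _; exists n => //; exists a.
apply: card_le_bigcup => [//||n _]; first exact: AS 0.
exact: card_le_trans (card_image_le _ _) (AS n).
Qed.

(** A subset into which every [aleph n] embeds has the size of [aleph_sum], so a strictly smaller
    one lies below some [aleph n]. *)
Lemma card_aleph_omegaP T (S : set T) :
  (forall n, [set: aleph n] #<= S) -> S #<= [set: aleph_sum] ->
  card_aleph_omega S.
Proof.
move=> AS SM; have Sge := card_ge_aleph_omegaP _ _ AS; split => // C CS [_ nSC].
have [AC|/existsNP[n nAC]] := pselect (forall n, [set: aleph n] #<= C).
  by case: nSC; apply: card_le_trans SM _; exact: card_aleph_sum_le.
have [//|CA] := card_le_total [set: aleph n] C.
have [B BS AB] := card_le_subset _ _ (AS n).
exists n, B; split => //; split.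
  by apply: is_aleph_eq AB _; exact: is_aleph_aleph.
by have /card_eqPle[leAB _] := AB; exact: card_le_trans CA leAB.
Qed.

(** * Subalgebras *)

(** [ecode n b] is the injection [e_b]; its values matter only on the predecessors of [b]. *)
Definition ecode n : aleph n.+1 -> aleph n.+1 -> aleph n :=
  projT1 (cid (hartogs_injections (aleph n) (@aleph_infinite n))).

Lemma ecode_inj n (b a a' : aleph n.+1) :
  hlt a b -> hlt a' b -> ecode n b a = ecode n b a' -> a = a'.
Proof. exact: (projT2 (cid (hartogs_injections (aleph n) (@aleph_infinite n)))). Qed.

Definition subalgebra (N : set aleph_sum) :=
  (forall k : aleph 0, N (existT aleph 0 k)) /\
  forall n (a b : aleph n.+1), hlt a b -> N (existT aleph n.+1 b) ->
    N (existT aleph n.+1 a) <-> N (existT aleph n (ecode n b a)).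

(** * Generated subalgebras and their size *)

Section Generated.
Variables (U : Type) (B : set U) (C : forall k, set (aleph k)).
Hypotheses (Binf : infinite_set B) (CB : forall k, C k #<= B).

Definition generate_down (S : forall k, set (aleph k)) k : set (aleph k) :=
  \bigcup_(b in S k.+1) (ecode k b @` [set a | S k.+1 a /\ hlt a b]).

(** Closure under decoding, the converse of [generate_down]. At level 0 everything enters, since a
    subalgebra contains [omega_0]. *)
Definition generate_up (S : forall k, set (aleph k)) k : set (aleph k) :=
  match k return set (aleph k) with
  | 0 => setT
  | k'.+1 => \bigcup_(b in S k'.+1) [set a | hlt a b /\ S k' (ecode k' b a)]
  end.

Fixpoint generate j k : set (aleph k) :=
  if j is j'.+1 then
    generate j' k `|` (generate_down (generate j') k `|` generate_up (generate j') k)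
  else C k.

Definition generated (m : aleph_sum) := exists j, generate j (tag m) (tagged m).

Lemma generate_mono i j k : (i <= j)%N -> generate i k `<=` generate j k.
Proof.
move=> /subnK <-; elim: (j - i)%N => [//|d IH] x /IH; rewrite addSn; by left.
Qed.

(** Both premises of a closure condition are present at the later of their two stages, and the next
    stage adds the conclusion. *)
Lemma generated_subalgebra : subalgebra generated.
Proof.
split=> [k|n a b ab [j jb]]; first by exists 1%N; right; right.
split=> -[i ia].
  exists (maxn i j).+1; right; left; exists b.
    exact: generate_mono (leq_maxr _ _) _ jb.
  by exists a => //; split=> //; exact: generate_mono (leq_maxl _ _) _ ia.
exists (maxn i j).+1; right; right; exists b.
  exact: generate_mono (leq_maxr _ _) _ jb.
by split=> //; exact: generate_mono (leq_maxl _ _) _ ia.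
Qed.

(** Coding downwards produces images; decoding upwards adds, for each [b], no more points than there
    are codes, as [e_b] is injective. *)
Lemma card_generate j k : generate j k #<= B.
Proof.
elim: j k => [//|j IH] k /=; apply: card_le_setU => //; apply: card_le_setU => //.
  apply: card_le_bigcup => // b _; apply: (card_le_trans (card_image_le _ _)).
  by apply: card_le_trans (IH k.+1); apply: subset_card_le => a [].
case: k => [|k]; first exact/infiniteP.
apply: card_le_bigcup => // b _; apply: card_le_trans (IH k).
apply: (card_le_fun (ecode k b)) => [a []//|a a' [ab _] [a'b _]].
exact: ecode_inj.
Qed.

Lemma card_generated k : [set a | generated (existT aleph k a)] #<= B.
Proof.
rewrite (_ : [set a | _] = \bigcup_(j in [set: nat]) generate j k).
  by apply: card_le_bigcup => //; [exact/infiniteP|move=> j _; exact: card_generate].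
by apply/seteqP; split=> a [j]; exists j.
Qed.

End Generated.

Lemma subalgebra_bigcap I (D : set I) (F : I -> set aleph_sum) :
  (forall i, D i -> subalgebra (F i)) -> subalgebra (\bigcap_(i in D) F i).
Proof.
move=> FS; split=> [k i Di|n a b ab Nb]; first exact: (FS _ Di).1.
by split=> Na i Di; apply/((FS _ Di).2 _ a b ab (Nb _ Di)); exact: Na.
Qed.

(** * Increasing chains of subalgebras *)

Section Chain.
Variables (I : Type) (lt : I -> I -> Prop) (N : I -> set aleph_sum).
Hypotheses (Ireg : regular_uncountable_cardinal lt)
  (Nsub : forall i, subalgebra (N i))
  (Nmono : forall i j, lt i j -> N i `<=` N j)
  (Ncov : forall m, exists i, N i m).

Lemma cofinal_card (C : set I) :
  (forall i, exists2 j, C j & ~ lt j i) -> [set: I] #<= C.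
Proof.
have [_ [_ [tot [_ [_ [_ reg]]]]]] := Ireg.
move=> Cub; apply: reg => i; have [j Cj ji] := Cub i.
exists j; split=> //; case: (tot i j) => [|[|]]; [by right|by left|by []].
Qed.

(* If no [N i] contains [aleph n.+1], the slice of each late [N i] in [aleph n.+2]
   has size at most [aleph n.+1], and so has [I]; but these slices cover
   [aleph n.+2]. *)
Lemma chain_stage n :
  (exists i, forall a : aleph n, N i (existT aleph n a)) ->
  exists i, forall a : aleph n.+1, N i (existT aleph n.+1 a).
Proof.
have [irr [trans [tot _]]] := Ireg.
move=> [i0 i0P]; apply: contrapT => /forallNP nP.
have ainf := aleph_infinite.
(* Let [f a] be an index at which [a] has entered. No [N i] contains all of [aleph n.+1], so the
   range of [f] is cofinal and regularity applies. *)
have IA : [set: I] #<= [set: aleph n.+1].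
  have /choice[f fP] : forall a : aleph n.+1, exists i, N i (existT aleph n.+1 a).
    by move=> a; exact: Ncov.
  apply: card_le_trans (card_image_le f setT); apply: cofinal_card => i.
  have /existsNP[a Na] := nP i.
  by exists (f a) => [|/Nmono]; [exists a|move=> /(_ _ (fP a))].
pose late i := i = i0 \/ lt i0 i.
have lateP i : late i -> forall a : aleph n, N i (existT aleph n a).
  by move=> [->//|/Nmono sub] a; exact: sub.
(* A missing point [x] bounds the slice: for [b] above [x] in [N i], the code of [x] lies in
   [aleph n], hence in [N i], which would force [x] into [N i]. *)
have cardW i : late i ->
    [set a | N i (existT aleph n.+1 a)] #<= [set: aleph n].
  move=> /lateP iP; have /existsNP[x Nx] := nP i.
  apply: card_le_trans (card_hlt _ x); apply: subset_card_le => b /= Nb.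
  case: (hlt_total _ b x) => [//|bx|xb]; first by case: Nx; rewrite -bx.
  by case: Nx; apply/((Nsub i).2 n x b xb Nb).
have cardVb i (b : aleph n.+2) : late i -> N i (existT aleph n.+2 b) ->
    [set a | N i (existT aleph n.+2 a) /\ hlt a b] #<= [set: aleph n].
  move=> li Nb; apply: card_le_trans (cardW _ li).
  apply: (card_le_fun (ecode n.+1 b)) => [a [Na ab]|a a' [_ ab] [_ a'b]].
    exact/((Nsub i).2 n.+1 a b ab Nb).
  exact: ecode_inj.
(* If [V] contains a copy [V'] of [aleph n.+1], let [c] bound [V']. Either [c] bounds [V] too, or
   some [b] in [V] lies above all of [V'], contradicting [cardVb]. *)
have cardV i : late i ->
    [set a | N i (existT aleph n.+2 a)] #<= [set: aleph n.+1].
  move=> li; set V := [set a | _].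
  have [//|/card_le_subset[V' V'V AV']] := card_le_total V [set: aleph n.+1].
  have /card_eqPle[leAV' leV'A] := AV'.
  have [c cP] := hartogs_regular _ (ainf n.+1) V' leV'A.
  have [Vc|/existsNP[b /not_implyP[Vb nbc]]] := pselect (forall b, V b -> hlt b c).
    by apply: card_le_trans (card_hlt _ c); exact: subset_card_le.
  case: (@card_hartogsN (aleph n)); apply: (card_le_trans leAV').
  apply: (card_le_trans _ (cardVb i b li Vb)); apply: subset_card_le => a V'a.
  split; first exact: V'V.
  case: (hlt_total _ c b) => [cb|<-|//]; last exact: cP.
  exact: hlt_trans (cP _ V'a) cb.
apply: (@card_hartogsN (aleph n.+1)).
rewrite (_ : setT = \bigcup_(i in late) [set a | N i (existT aleph n.+2 a)]).
  apply: card_le_bigcup => //.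
  by apply: card_le_trans IA; exact: card_leT.
apply/seteqP; split=> // a _; have [i Na] := Ncov (existT aleph n.+2 a).
(* An index before [i0] is replaced by [i0] itself. *)
case: (tot i i0) => [ii0|[ii0|i0i]].
- by exists i0; [left|exact: Nmono Na].
- by exists i; [left|].
- by exists i; [right|].
Qed.

(** The countably many stages [f n] that absorb the cardinals [aleph n] are not cofinal in an
    uncountable regular [I]; any strict upper bound of them works. *)
Lemma chain_stationary : exists i, N i = setT.
Proof.
have [_ [_ [_ [_ [_ [unc _]]]]]] := Ireg.
have stage n : exists i, forall a : aleph n, N i (existT aleph n a).
  elim: n => [|n]; last exact: chain_stage.
  have [i _] : [set: I] !=set0.
    by apply/set0P/eqP => I0; apply: unc; rewrite I0; exact: countable0.
  by exists i; exact: (Nsub i).1.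
have [f fP] := choice stage.
have [ub|/existsNP[i nub]] := pselect (forall i, exists2 j, range f j & ~ lt j i).
  by case: unc; apply: card_le_trans (cofinal_card _ ub) (card_image_le _ _).
exists i; apply/seteqP; split=> // -[n a] _; apply: (@Nmono (f n)); last exact: fP.
by apply: contrapT => nlt; apply: nub; exists (f n) => //; exists n.
Qed.

End Chain.

(** * The space of subalgebras *)

HB.instance Definition _ := gen_eqMixin aleph_sum.

Definition subalgebras : Type := {N | subalgebra N}.

HB.instance Definition _ := gen_eqMixin subalgebras.
HB.instance Definition _ := gen_choiceMixin subalgebras.

Implicit Types (x y : subalgebras) (t : seq (aleph_sum * bool)).

(** Traces of the basic open sets of [2^M]: [t] prescribes finitely many memberships, possibly
    contradictory ones. *)
Definition cylinder t : set subalgebras :=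
  [set x | forall m c, (m, c) \in t -> `[< sval x m >] = c].

Definition cylinder_nbhs x : set_system subalgebras :=
  [set V | exists2 t, cylinder t x & cylinder t `<=` V].

HB.instance Definition _ := hasNbhs.Build subalgebras cylinder_nbhs.

Lemma cylinder_cat t t' : cylinder (t ++ t') = cylinder t `&` cylinder t'.
Proof.
apply/seteqP; split=> x.
  by move=> xt; split=> m c mt; apply: xt; rewrite mem_cat mt ?orbT.
by move=> [xt xt'] m c; rewrite mem_cat => /orP[/xt|/xt'].
Qed.

Lemma cylinder_nbhs_filter x : ProperFilter (nbhs x).
Proof.
apply: Build_ProperFilter_ex => [V [t xt tV]|]; first by exists x; exact: tV.
split=> [|V W [t xt tV] [t' xt' tW]|V W VW [t xt tV]].
- by exists [::].
- exists (t ++ t'); rewrite cylinder_cat; first by split.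
  by move=> y [/tV Vy /tW Wy].
- by exists t => // y /tV /VW.
Qed.

Lemma cylinder_nbhs_singleton x (V : set subalgebras) : nbhs x V -> V x.
Proof. by move=> [t xt]; apply. Qed.

Lemma cylinder_nbhs_nbhs x (V : set subalgebras) :
  nbhs x V -> nbhs x (nbhs^~ V).
Proof. by move=> [t xt tV]; exists t => // y yt; exists t. Qed.

HB.instance Definition _ := Nbhs_isNbhsTopological.Build subalgebras
  cylinder_nbhs_filter cylinder_nbhs_singleton cylinder_nbhs_nbhs.

Lemma open_cylinder t : open (cylinder t).
Proof. by rewrite openE => x xt; exists t. Qed.

Lemma nbhs_coordinate x m : nbhs x [set y | sval y m <-> sval x m].
Proof.
exists [:: (m, `[< sval x m >])] => [m' c|y /(_ m _ (mem_head _ _))].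
  by rewrite inE => /eqP[-> ->].
by move=> e; split=> /asboolP ym; apply/asboolP; move: ym; rewrite e.
Qed.

Lemma subalgebras_ext x y : (forall m, sval x m <-> sval y m) -> x = y.
Proof.
by case: x y => [N Np] [M Mp] /= NM; apply: eq_exist; apply/seteqP; split=> m /NM.
Qed.

Lemma subalgebras_hausdorff : hausdorff_space subalgebras.
Proof.
move=> x y xy; apply: subalgebras_ext => m.
have [z [/= zx zy]] := xy _ _ (nbhs_coordinate x m) (nbhs_coordinate y m).
by split=> [/zx/zy|/zy/zx].
Qed.

(** Each closure condition is an implication between finitely many memberships, so it passes to the
    limit along a filter. This is the closedness in [2^M]. *)
Lemma ultra_limit_subalgebra (F : set_system subalgebras) : Filter F ->
  subalgebra [set m | F [set x | sval x m]].
Proof.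
move=> FF; split=> [k|n a b ab Fb] /=.
  by apply: filterS filterT => x _; exact: (proj2_sig x).1.
by split=> Fa; apply: filterS (filterI Fb Fa) => x [/= xb xa];
  apply/((proj2_sig x).2 n a b ab xb).
Qed.

Lemma subalgebras_compact : compact [set: subalgebras].
Proof.
rewrite compact_ultra => F FU _; have FF : Filter F by exact: _.
exists (exist _ _ (ultra_limit_subalgebra F FF)); split=> // V [t yt tV].
(* A cylinder is a finite intersection of one-coordinate conditions; the ultrafilter property
   settles the negative ones. *)
apply: filterS tV _; elim: t yt => [|[m c] t IH] yt; first exact: filterS filterT.
rewrite -cat1s cylinder_cat; apply: filterI; last first.
  by apply: IH => m' c' m't; apply: yt; rewrite inE m't orbT.
have := yt m c (mem_head _ _); case: c {yt} => [/asboolP|/asboolPn] /= Fm.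
  by apply: filterS Fm => x xm m' c'; rewrite inE => /eqP[-> ->]; exact/asboolP.
have [//|] := in_ultra_setVsetC [set x | sval x m] FU.
by apply: filterS => x xm m' c'; rewrite inE => /eqP[-> ->]; apply/asboolPn.
Qed.

(** * Character and weight *)

Lemma subalgebra_setT : subalgebra setT. Proof. by []. Qed.

Definition full_algebra : subalgebras := exist _ setT subalgebra_setT.

(** If [L] has size at most [aleph n], so has the set of coordinates at each level used by cylinders
    inside its members. The subalgebra [q] they generate lies in every member of [L] yet misses a
    point of [aleph n.+1]. *)
Lemma local_base_card (L : set (set subalgebras)) n :
  local_base full_algebra L -> [set: aleph n] #<= L.
Proof.
move=> [Lopen Lbase]; have [//|LA] := card_le_total [set: aleph n] L.
exfalso.
have /choice[t tP] : forall V, exists t, L V ->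
    cylinder t full_algebra /\ cylinder t `<=` V.
  move=> V; have [LV|nLV] := pselect (L V); last by exists [::].
  have [Vo Vp] := Lopen _ LV.
  have [t pt tV] : nbhs full_algebra V by exact: open_nbhs_nbhs.
  by exists t.
pose C k := \bigcup_(V in L) [set a | (existT aleph k a, true) \in t V].
have ainf := aleph_infinite n.
have CA k : C k #<= [set: aleph n].
  apply: card_le_bigcup => // V LV.
  apply: (@card_le_trans _ _ _ [set` t V]); last first.
    apply: (card_le_trans _ ((infiniteP _).1 ainf)).
    exact: finite_set_countable (finite_seq _).
  apply: (card_le_fun (fun a => (existT aleph k a, true))) => // a a' _ _.
  by move=> /(congr1 fst); exact: existT_inj2.
pose q : subalgebras := exist _ _ (generated_subalgebra C).
have qL V : L V -> V q.
  move=> LV; have [pt tV] := tP _ LV; apply: tV => -[k a] c kac.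
  (* Every constraint in [t V] is positive, because [full_algebra] satisfies it. *)
  have := pt _ _ kac; rewrite /= asboolT // => cT; rewrite -{c}cT in kac *.
  by apply/asboolP; exists 0%N; exists V.
have /existsNP[a qa] : ~ forall a : aleph n.+1, generated C (existT aleph n.+1 a).
  move=> all; apply: (@card_hartogsN (aleph n)).
  apply: card_le_trans (card_generated _ _ C ainf CA n.+1).
  by apply: subset_card_le => a _; exact: all.
have [V [LV /(_ q (qL _ LV))]] :=
  Lbase _ (nbhs_coordinate full_algebra (existT aleph n.+1 a)).
by move=> [_ /(_ I)].
Qed.

Definition cylinders : set (set subalgebras) := range cylinder.

Lemma cylinders_base : is_base cylinders.
Proof.
split=> [_ [t _ <-]|V x]; first exact: open_cylinder.
rewrite openE => Vo /Vo[t xt tV].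
by exists (cylinder t); split; [exists t|].
Qed.

Lemma card_cylinders : cylinders #<= [set: aleph_sum].
Proof.
have Minf : infinite_set [set: aleph_sum].
  apply/infiniteP; apply: (card_le_fun (fun k : nat => existT aleph 0 k)) => //.
  by move=> k k' _ _; exact: existT_inj2.
apply: (card_le_trans (card_image_le _ _)); apply: card_le_seq => //.
rewrite -setXTT; apply: card_le_trans (card_le_square _ Minf).
apply: card_le_setX => //; apply: (card_le_trans _ ((infiniteP _).1 Minf)).
exact: countableP.
Qed.

Lemma is_base_local_base (X : topologicalType) (p : X) (B : set (set X)) :
  is_base B -> local_base p [set V | B V /\ V p].
Proof.
move=> [Bo Bb]; split=> [V [/Bo]//|V]; rewrite nbhsE => -[W [Wo Wp] WV].
have [Z [BZ [Zp ZW]]] := Bb _ _ Wo Wp.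
by exists Z; split=> //; exact: subset_trans WV.
Qed.

Lemma full_algebra_limitN I (lt : I -> I -> Prop) (x : I -> subalgebras) :
  regular_uncountable_cardinal lt -> (forall i, x i <> full_algebra) ->
  ~ seq_converges lt x full_algebra.
Proof.
move=> Ireg xp xcvg; have [_ [trans _]] := Ireg.
pose N i := \bigcap_(j in [set j | j = i \/ lt i j]) sval (x j).
have [] := @chain_stationary _ _ N Ireg.
- by move=> i; apply: subalgebra_bigcap => j _; exact: proj2_sig.
- by move=> i j ij m Nm k [->|jk]; apply: Nm; right => //; exact: trans jk.
(* The subalgebras containing [m] form a neighbourhood of [full_algebra], so a whole tail contains
   [m]. *)
- move=> m; have [i iP] := xcvg _ (nbhs_coordinate full_algebra m).
  by exists i => j /iP [_]; apply.
move=> i NT; apply: (xp i); apply: subalgebras_ext => m; split=> // _.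
have : N i m by rewrite NT.
by apply; left.
Qed.

Theorem theorem1 :
  exists (X : topologicalType) (p : X),
    compact [set: X] /\ hausdorff_space X /\
    character_aleph_omega p /\ weight_aleph_omega X /\
    (forall (I : Type) (lt : I -> I -> Prop),
        regular_uncountable_cardinal lt ->
        ~ (exists x : I -> X, (forall a, x a <> p) /\ seq_converges lt x p)).
Proof.
(* The members of a base that contain [full_algebra] form a local base, so the lower bound on the
   character bounds the weight too. *)
have base_card (B : set (set subalgebras)) :
    is_base B -> forall n, [set: aleph n] #<= B.
  move=> Bb n; have Bl := is_base_local_base _ full_algebra _ Bb.
  apply: (card_le_trans (local_base_card _ n Bl)).
  by apply: subset_card_le => V [].
exists subalgebras, full_algebra; split; first exact: subalgebras_compact.
split; first exact: subalgebras_hausdorff.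
split; [split|split; [split|]].
- have cyl := is_base_local_base _ full_algebra _ cylinders_base.
  exists [set V | cylinders V /\ V full_algebra]; split=> //.
  apply: card_aleph_omegaP => [n|]; first exact: local_base_card.
  by apply: card_le_trans card_cylinders; apply: subset_card_le => V [].
- by move=> L Ll; apply: card_ge_aleph_omegaP => n; exact: local_base_card.
- exists cylinders; split; first exact: cylinders_base.
  apply: card_aleph_omegaP card_cylinders => n.
  exact: base_card cylinders_base n.
- by move=> B Bb; apply: card_ge_aleph_omegaP; exact: base_card.
- by move=> I lt Ireg [x [xp]]; exact: full_algebra_limitN.
Qed.
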